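(* For every integer $k\ge 3$ and every graph $F$ of maximum degree at most $k$, if a $k$-edge-connected graph $G$ contains a vertex with at least $d(k)|V(F)|$ distinct neighbors, where $d(k)=(2k+1)^{8k+4}k^2(k+1)$, then $F$ appears in $G$ as a strong immersion.
   Context: Graphs are finite and may have parallel edges and loops; each loop contributes $2$ to the degree of its vertex. An immersion of a graph $H$ in a graph $G$ is a function $\theta$ on the vertices and edges of $H$ such that: (a) $\theta(v)$ is a vertex of $G$ for each $v\in V(H)$, and $\theta$ restricted to $V(H)$ is injective; (b) $\theta(e)$ is a connected subgraph of $G$ for each $e\in E(H)$, and for distinct $e,f\in E(H)$ the subgraphs $\theta(e)$ and $\theta(f)$ are edge-disjoint; (c) if $e\in E(H)$ is incident with $v\in V(H)$, then $\theta(v)$ is a vertex of $\theta(e)$, and if $e$ is a loop, then $\theta(e)$ contains a cycle passing through $\theta(v)$. The immersion is strong if, in addition, whenever $e\in E(H)$ is not incident with $v\in V(H)$, $\theta(e)$ does not contain $\theta(v)$. ''$F$ appears in $G$ as a strong immersion'' means that there is a strong immersion of $F$ in $G$. *)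

(* Defs.v *)
From mathcomp Require Import all_boot.

Set Implicit Arguments.
Unset Strict Implicit.
Unset Printing Implicit Defensive.

(** Undirected finite graphs, with loops and parallel edges allowed.  The two
    ends of an edge are stored in an arbitrary order; every notion below is
    insensitive to that order. *)
Record graph := Graph {
  vertex : finType;
  edge : finType;
  end1 : edge -> vertex;
  end2 : edge -> vertex }.

Arguments end1 {g}.
Arguments end2 {g}.

Section Graphs.
Variable G : graph.
Implicit Types (e f : edge G) (u v w : vertex G).

Definition joins e u v : bool :=
  ((end1 e == u) && (end2 e == v)) || ((end1 e == v) && (end2 e == u)).

Definition incident e v : bool := (end1 e == v) || (end2 e == v).

Definition is_loop e : bool := end1 e == end2 e.

(** A loop at [v] contributes 2. *)
Definition degree v : nat :=
  \sum_(e : edge G) ((end1 e == v) + (end2 e == v)).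

Definition max_degree : nat := \max_(v : vertex G) degree v.

(** A loop does not make a vertex a neighbor of itself. *)
Definition neighbors v : {set vertex G} :=
  [set u | (u != v) && [exists e, joins e v u]].

Record subgraph := Subgraph {
  verts : {set vertex G};
  edges : {set edge G};
  ends_in_verts :
    forall e, e \in edges -> (end1 e \in verts) && (end2 e \in verts) }.

Definition adjacent_in (H : subgraph) : rel (vertex G) :=
  [rel u v | [exists e in edges H, joins e u v]].

Definition connected (H : subgraph) : Prop :=
  verts H != set0 /\ {in verts H &, forall u v, connect (adjacent_in H) u v}.

Fact delete_edges_subproof (X : {set edge G}) e :
  e \in ~: X -> (end1 e \in [set: vertex G]) && (end2 e \in [set: vertex G]).
Proof. by rewrite !in_setT. Qed.

Definition delete_edges (X : {set edge G}) : subgraph :=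
  Subgraph (@delete_edges_subproof X).

Definition edge_connected (k : nat) : Prop :=
  1 < #|vertex G| /\
  forall X : {set edge G}, #|X| < k -> connected (delete_edges X).

(** A cycle is listed as (v_0, e_0), ..., (v_(l-1), e_(l-1)), where e_i joins
    v_i to v_(i+1 mod l).  A loop is a cycle of length 1, and two parallel
    edges form a cycle of length 2. *)
Definition is_cycle (c : seq (vertex G * edge G)) : bool :=
  [&& c != [::], uniq [seq d.1 | d <- c], uniq [seq d.2 | d <- c]
    & cycle [rel d d' | joins d.2 d.1 d'.1] c].

Definition contains_cycle_through (H : subgraph) v : Prop :=
  exists c : seq (vertex G * edge G),
    [/\ is_cycle c, {subset [seq d.1 | d <- c] <= verts H},
        {subset [seq d.2 | d <- c] <= edges H} & v \in [seq d.1 | d <- c]].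

End Graphs.

Record immersion (H G : graph) := Immersion {
  imm_vertex : vertex H -> vertex G;
  imm_edge : edge H -> subgraph G;
  imm_vertex_inj : injective imm_vertex;
  imm_edge_connected : forall e, connected (imm_edge e);
  imm_edge_disjoint :
    forall e f, e != f -> [disjoint edges (imm_edge e) & edges (imm_edge f)];
  imm_incident :
    forall e v, incident e v -> imm_vertex v \in verts (imm_edge e);
  imm_loop :
    forall e v, incident e v -> is_loop e ->
      contains_cycle_through (imm_edge e) (imm_vertex v) }.

Definition strong (H G : graph) (theta : immersion H G) : Prop :=
  forall e v, ~~ incident e v ->
    imm_vertex theta v \notin verts (imm_edge theta e).

Definition appears_as_strong_immersion (F G : graph) : Prop :=
  exists theta : immersion F G, strong theta.

Definition d (k : nat) : nat := (2 * k + 1) ^ (8 * k + 4) * k ^ 2 * (k + 1).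

(* Main.v *)
Require Import Defs.
From mathcomp Require Import all_boot.
From mathcomp Require Import zify.

(** Let [v] be a vertex with many neighbors.  It suffices to find distinct
    vertices [r_u], one for each vertex [u] of [F], with [k] paths from each
    [r_u] to [v], all these paths edge-disjoint and avoiding the other [r_w]:
    an edge [uw] of [F] is then routed from [r_u] through [v] to [r_w].

    Delete edges, other than one spoke from [v] to each neighbor, as long as
    every set that avoids [v] and contains a neighbor keeps at least [k] edges
    leaving it.  Each remaining non-spoke edge then leaves a tight set (one
    with exactly [k] leaving edges), and uncrossing gives disjoint tight sets
    meeting all non-spoke edges.  A tight set contains at most [k] neighbors,
    because of the spokes, so there are many of them.  Cut the edges at every
    vertex outside the tight sets into blocks of bounded size, and call two
    tight sets adjacent if they meet a common block.  This graph has bounded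
    degree, so it has many tight sets that are pairwise far apart.  The edges
    near one of them already carry [k] units of flow from it to [v], since a
    connected cluster of [k] tight sets sends [k] spokes to [v].  Hence the cut
    condition of Menger's theorem holds for one neighbor [r_u] in each chosen
    tight set.  The [k] paths from [r_u] use up all the edges leaving its tight
    set, so no other path enters it. *)

Set Implicit Arguments.
Unset Strict Implicit.
Unset Printing Implicit Defensive.

(** * Finite sets and balls in graphs of bounded degree *)

Lemma card_set_in (T : finType) (D : {set T}) (P : pred T) :
  #|[set x in D | P x]| = \sum_(x in D) P x.
Proof.
rewrite -sum1_card (eq_bigl (fun x => (x \in D) && P x)); last first.
  by move=> x; rewrite inE.
by rewrite big_mkcondr; apply: eq_bigr => x _; case: (P x).
Qed.

(** While more than [2 * K] elements remain, split off a block of exactly [K]. The rest still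
    exceeds [K], so a block below [K] arises only if it is all of [A]. *)
Lemma exists_block_labels (T : finType) (K : nat) (A : {set T}) : 0 < K ->
  exists b : T -> nat, forall x, x \in A ->
    #|[set y in A | b y == b x]| <= 2 * K /\
    (K <= #|[set y in A | b y == b x]| \/ [set y in A | b y == b x] = A).
Proof.
move=> K0; have [m] := ubnP #|A|; elim: m => // m IHm in A * => lt_m.
have [small|big] := leqP #|A| (2 * K).
  exists (fun=> 0) => x xA; have -> : [set y in A | 0 == 0] = A.
    by apply/setP => y; rewrite inE eqxx andbT.
  by split=> //; right.
have [B BA cB] : exists2 B : {set T}, B \subset A & #|B| = K.
  exists [set x in take K (enum A)].
    by apply/subsetP => x; rewrite inE => /mem_take; rewrite mem_enum.
  rewrite cardsE (card_uniqP _) ?take_uniq ?enum_uniq // size_take -cardE.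
  by rewrite (leq_ltn_trans _ big) // leq_pmull.
have cAB : #|A :\: B| = #|A| - K by rewrite cardsD (setIidPr BA) cB.
have [|b hb] := IHm (A :\: B); first lia.
exists (fun y => if y \in B then 0 else (b y).+1) => x xA.
case xB: (x \in B).
  have -> : [set y in A | (if y \in B then 0 else (b y).+1) == 0] = B.
    apply/setP => y; rewrite inE; case yB: (y \in B); rewrite ?andbF //.
    by rewrite (subsetP BA).
  by rewrite cB; split; [lia | left].
have -> : [set y in A | (if y \in B then 0 else (b y).+1) == (b x).+1]
          = [set y in A :\: B | b y == b x].
  apply/setP => y; rewrite !inE; case: (y \in B); rewrite /= ?andbF //.
have [|le ge] := hb x; first by rewrite inE xB.
split=> //; left; case: ge => [//|->]; lia.
Qed.

(** Greedy choice: each chosen element rules out at most [M] elements, itself included. *)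
Lemma exists_spread_subset (T : finType) (R : rel T) (M n : nat)
    (A : {set T}) :
    0 < M -> reflexive R -> symmetric R ->
    (forall x, #|[set y | R x y]| <= M) -> n * M <= #|A| ->
  exists2 I : {set T}, I \subset A & #|I| = n /\
    {in I &, forall x y, R x y -> x = y}.
Proof.
move=> M0 Rr Rs RM; elim: n A => [|n IHn] A nA.
  exists set0; first exact: sub0set.
  by split; [exact: cards0 | move=> x y; rewrite inE].
have [A0|[x xA]] := set_0Vmem A.
  by move: nA; rewrite A0 cards0 mulSn; lia.
have cD := cardsD A [set y | R x y].
have cI := subset_leq_card (subsetIr A [set y | R x y]).
have [|I IA [cardI Isep]] := IHn (A :\: [set y | R x y]).
  by have := RM x; rewrite mulSn in nA; lia.
have notR y : y \in I -> ~~ R x y.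
  by move=> /(subsetP IA); rewrite !inE => /andP[].
have xI : x \notin I by apply/negP => /notR; rewrite Rr.
exists (x |: I).
  by rewrite subUset sub1set xA (subset_trans IA) ?subsetDl.
split=> [|y z]; first by rewrite cardsU1 xI cardI.
rewrite !inE => /predU1P[->|yI] /predU1P[->|zI] //; last exact: Isep.
- by rewrite (negPf (notR _ zI)).
- by rewrite Rs (negPf (notR _ yI)).
Qed.

(** Until a fixed point is reached, every application of [f] adds an element. *)
Lemma iter_growth (T : finType) (f : {set T} -> {set T}) (A : {set T})
    (q : nat) :
    (forall B : {set T}, B \subset f B) -> A != set0 ->
  q < #|iter q f A| \/
  exists m, [/\ m < q, #|iter m f A| <= q & f (iter m f A) = iter m f A].
Proof.
move=> fsub A0; elim: q => [|q [lt|[m [mq cm fm]]]] /=.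
- by left; rewrite card_gt0.
- have [fix_q|ne] := eqVneq (f (iter q f A)) (iter q f A).
    have [big|small] := ltnP q.+1 #|iter q f A|; first by left; rewrite fix_q.
    by right; exists q; split.
  left; apply: leq_ltn_trans lt _; apply: proper_card.
  by rewrite properEneq eq_sym ne fsub.
- by right; exists m; split=> //; lia.
Qed.

Lemma card_bigcup_le (I T : finType) (A : {set I}) (F : I -> {set T}) :
  #|\bigcup_(i in A) F i| <= \sum_(i in A) #|F i|.
Proof.
elim/big_rec2: _ => [|i n B _ le]; first by rewrite cards0.
by have := cardsUI (F i) B; lia.
Qed.

Lemma sum_card_le (I T : finType) (A : {set I}) (F : I -> {set T})
    (B : {set T}) :
    {in A, forall i, F i \subset B} ->
    {in A &, forall i j x, x \in F i -> x \in F j -> i = j} ->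
  \sum_(i in A) #|F i| <= #|B|.
Proof.
move=> FB Fdisj; rewrite -sum1_card.
apply: (@leq_trans (\sum_(i in A) \sum_(x in B) (x \in F i))).
  apply: leq_sum => i iA; rewrite -card_set_in; apply: subset_leq_card.
  by apply/subsetP => x xF; rewrite inE xF (subsetP (FB i iA)).
rewrite exchange_big; apply: leq_sum => x _; rewrite -card_set_in.
by apply/card_le1_eqP => i j; rewrite !inE => /andP[iA xi] /andP[jA xj];
  apply: Fdisj jA iA _ xj xi.
Qed.

Section Balls.

Variables (T : finType) (r : rel T).

Definition nbhd x : {set T} := [set y | (x == y) || r x y].

Fixpoint ball m x : {set T} :=
  if m is m'.+1 then \bigcup_(y in ball m' x) nbhd y else [set x].

Lemma card_ball B m x : (forall y, #|nbhd y| <= B) -> #|ball m x| <= B ^ m.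
Proof.
move=> hB; elim: m => [|m IHm] /=; first by rewrite cards1.
apply: leq_trans (card_bigcup_le _ _) _.
apply: leq_trans (_ : \sum_(y in ball m x) B <= _); first exact: leq_sum.
by rewrite sum_nat_const expnSr leq_mul2r IHm orbT.
Qed.

Lemma ball_step m x y z : y \in ball m x -> (y == z) || r y z ->
  z \in ball m.+1 x.
Proof. by move=> yx yz; apply/bigcupP; exists y; rewrite // inE. Qed.

Lemma ball_add m n x y z : y \in ball m x -> z \in ball n y ->
  z \in ball (m + n) x.
Proof.
move=> yx; elim: n z => [|n IHn] z /=.
  by rewrite inE addn0 => /eqP->.
case/bigcupP => w /IHn wx; rewrite inE addnS; exact: ball_step.
Qed.

Lemma ball_mono m n x : m <= n -> ball m x \subset ball n x.
Proof.
move=> /subnK <-; rewrite addnC; elim: (n - m) => [|i IHi]; rewrite ?addn0 //.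
apply: subset_trans IHi _; apply/subsetP => y yx; rewrite addnS.
by apply: ball_step yx _; rewrite eqxx.
Qed.

Lemma ball_refl m x : x \in ball m x.
Proof. by apply: (subsetP (ball_mono x (leq0n m))); rewrite inE. Qed.

Lemma ball_sym m x y : symmetric r -> y \in ball m x -> x \in ball m y.
Proof.
move=> rs; elim: m y => [|m IHm] y /=; first by rewrite !inE eq_sym.
case/bigcupP => z /IHm xz; rewrite inE => yz.
apply: (@ball_add 1 m y z x) => //.
by apply: (@ball_step 0 y y z); rewrite ?inE // eq_sym rs.
Qed.

End Balls.

(** * Menger's theorem *)

Section DirectedLinkage.

Variables (V A : finType) (tail head : A -> V).
Implicit Types (D : {set A}) (X Y U : {set V}) (v : V).

Definition out_arcs D Y : {set A} :=
  [set a in D | (tail a \in Y) && (head a \notin Y)].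

Definition arc_step D : rel V :=
  [rel x y | [exists a in D, (tail a == x) && (head a == y)]].

Lemma out_arcs_submod D X Y :
  #|out_arcs D (X :|: Y)| + #|out_arcs D (X :&: Y)|
    <= #|out_arcs D X| + #|out_arcs D Y|.
Proof.
rewrite !card_set_in -!big_split /=; apply: leq_sum => a _; rewrite !inE.
by do 4 case: (_ \in _).
Qed.

(** Menger's cut condition for sending one token per [i] from [src i] to [v]; several tokens may
    share a vertex. *)
Definition routable v D (I : finType) (src : I -> V) : bool :=
  [forall Y : {set V}, (v \notin Y) ==> (#|src @^-1: Y| <= #|out_arcs D Y|)].

Lemma routableP v D (I : finType) (src : I -> V) :
  reflect (forall Y, v \notin Y -> #|src @^-1: Y| <= #|out_arcs D Y|)
          (routable v D src).
Proof. by apply: (iffP forallP) => H Y; apply/implyP; apply: H. Qed.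

(* A token on [u] can move along [a] unless [a] enters a tight set; if every
   arc leaving [u] did, the union of these tight sets together with [u] would
   violate the cut condition. *)
Lemma exists_safe_arc v D (I : finType) (src : I -> V) i :
    routable v D src -> src i != v ->
  exists a, [/\ a \in D, tail a = src i &
    forall Y, v \notin Y -> src i \notin Y -> head a \in Y ->
      #|src @^-1: Y| < #|out_arcs D Y|].
Proof.
move=> /routableP rt iNv; set u := src i.
pose safe a := [forall Y : {set V}, [&& v \notin Y, u \notin Y & head a \in Y]
                 ==> (#|src @^-1: Y| < #|out_arcs D Y|)].
have [/existsP[a /and3P[aD /eqP au /forallP sa]]|none] :=
  boolP [exists a, [&& a \in D, tail a == u & safe a]].
  exists a; split=> // Y vY uY aY; apply: (implyP (sa Y)).
  by rewrite vY uY aY.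
pose tight Y := [&& v \notin Y, u \notin Y & #|out_arcs D Y| <= #|src @^-1: Y|].
have t0 : tight set0.
  rewrite /tight !inE /= (_ : out_arcs D set0 = set0) ?cards0 //.
  by apply/setP => a; rewrite !inE andbF.
have [U tU Umax] : {U | tight U & forall Y, tight Y -> #|Y| <= #|U|}.
  by case: (arg_maxnP (fun Y : {set V} => #|Y|) t0) => U; exists U.
(* By submodularity tight sets are closed under union, so a largest one contains them all. *)
have subU Y : tight Y -> Y \subset U.
  move=> tY; case/and3P: (tU) => vU uU cU; case/and3P: (tY) => vY uY cY.
  suff /Umax : tight (Y :|: U).
    move=> le; have /eqP eU : U == Y :|: U by rewrite eqEcard subsetUr le.
    by rewrite eU subsetUl.
  rewrite /tight !inE !negb_or vU uU vY uY /=.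
  have := out_arcs_submod D Y U; have := rt (Y :&: U).
  rewrite !inE (negPf vU) andbF => /(_ isT).
  have := cardsUI (src @^-1: Y) (src @^-1: U).
  rewrite preimsetU preimsetI; lia.
case/and3P: (tU) => vU uU cU.
have := rt (u |: U); rewrite !inE negb_or vU andbT eq_sym => /(_ iNv).
have sub : out_arcs D (u |: U) \subset out_arcs D U.
  apply/subsetP => a; rewrite !inE negb_or => /and3P[aD aT /andP[_ aH]].
  rewrite aD aH andbT /=; case/orP: aT => // /eqP au.
  have : ~~ safe a.
    by apply: contra none => sa; apply/existsP; exists a; rewrite aD au eqxx.
  rewrite negb_forall => /existsP[Y]; rewrite negb_imply -leqNgt.
  case/andP=> /and3P[vY uY aY] cY; have /subU/subsetP/(_ _ aY) : tight Y.
    exact/and3P.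
  by rewrite (negPf aH).
have := subset_leq_card sub.
have : #|src @^-1: U| < #|src @^-1: (u |: U)|.
  apply: proper_card; apply/properP; split; first exact/preimsetS/subsetUr.
  by exists i; rewrite !inE ?eqxx.
lia.
Qed.

(** If [a] leaves [Y], the token leaves [Y] along with the deleted arc. If [a] enters [Y], the
    strict inequality makes room for the token. *)
Lemma routable_move v D (I : finType) (src : I -> V) i a :
    routable v D src -> a \in D -> tail a = src i ->
    (forall Y, v \notin Y -> src i \notin Y -> head a \in Y ->
       #|src @^-1: Y| < #|out_arcs D Y|) ->
  routable v (D :\ a) (fun j => if j == i then head a else src j).
Proof.
move=> /routableP rt aD ai safe; apply/routableP => Y vY.
set src' := fun j => _.
have out' : out_arcs (D :\ a) Y = out_arcs D Y :\ a.
  by apply/setP => b; rewrite !inE -andbA.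
have pre' : (src' @^-1: Y) :\ i = (src @^-1: Y) :\ i.
  by apply/setP => j; rewrite !inE /src'; case: eqP.
have := cardsD1 i (src' @^-1: Y); have := cardsD1 i (src @^-1: Y).
have := cardsD1 a (out_arcs D Y); rewrite pre' out' !inE /src' eqxx aD ai /=.
have := rt Y vY; have := safe Y vY.
case: (src i \in Y); case: (head a \in Y) => //=; try lia.
Qed.

(** Induction on the number of arcs: move a token along a safe arc, delete the arc, and add it to
    the path found for that token. *)
Theorem directed_linkage v D (I : finType) (src : I -> V) :
    routable v D src ->
  exists P : I -> {set A},
    [/\ forall i, P i \subset D,
        forall i j, i != j -> [disjoint P i & P j] &
        forall i, connect (arc_step (P i)) (src i) v].
Proof.
have [m] := ubnP #|D|; elim: m => // m IHm in D src * => lt_m rt.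
have [i iNv|all_v] := pickP [pred i | src i != v]; last first.
  exists (fun=> set0); split=> [i|i j _|i]; first exact: sub0set.
    by rewrite disjoints_subset sub0set.
  by have /negbFE/eqP-> := all_v i.
have [a [aD ai safe]] := exists_safe_arc rt iNv.
have rt' := routable_move rt aD ai safe.
have [|P [PD Pdisj Pcon]] := IHm _ _ _ rt'.
  by move: lt_m; rewrite (cardsD1 a D) aD; lia.
exists (fun j => if j == i then a |: P j else P j).
have aP j : a \notin P j.
  by apply/negP => /(subsetP (PD j)); rewrite !inE eqxx.
split=> [j|j1 j2 ne|j].
- have PjD : P j \subset D by apply: subset_trans (PD j) (subD1set _ _).
  by case: eqP => // _; rewrite subUset sub1set aD.
- have := Pdisj _ _ ne; rewrite -!setI_eq0 => /eqP Pj.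
  case: (j1 =P i) (j2 =P i) => [e1|_] [e2|_]; last by rewrite Pj.
  + by rewrite e1 e2 eqxx in ne.
  + by rewrite setIUl Pj setU0 setI_eq0 disjoints1.
  + by rewrite setIUr Pj setU0 setIC setI_eq0 disjoints1.
- have := Pcon j; case: eqP => [->|//] con.
  apply: (@connect_trans _ _ (head a)).
    apply: connect1; apply/existsP; exists a.
    by rewrite !inE ai !eqxx.
  apply: connect_sub con => x y /existsP[b /andP[bP xy]]; apply: connect1.
  by apply/existsP; exists b; rewrite inE bP orbT.
Qed.

End DirectedLinkage.

(** * Cuts and the undirected form of Menger's theorem *)

Section Cuts.

Variable G : graph.
Implicit Types (E : {set edge G}) (X Y : {set vertex G}) (v x y : vertex G).

Definition cut E Y : {set edge G} :=
  [set e in E | (end1 e \in Y) (+) (end2 e \in Y)].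

Definition edge_adj E : rel (vertex G) :=
  [rel x y | [exists e in E, joins e x y]].

Lemma joinsC (e : edge G) x y : joins e x y = joins e y x.
Proof. by rewrite /joins orbC. Qed.

Lemma joins_inj (e : edge G) x y y' : joins e x y -> joins e x y' -> y = y'.
Proof.
rewrite /joins; case/orP=> /andP[/eqP<- /eqP<-];
  case/orP=> /andP[/eqP e1 /eqP e2]; congruence.
Qed.

Lemma edge_adj_sym E : symmetric (edge_adj E).
Proof. by move=> x y; apply: eq_existsb => e; rewrite joinsC. Qed.

Lemma cut_sub E Y : cut E Y \subset E.
Proof. by apply/subsetP => e; rewrite inE => /andP[]. Qed.

Lemma cut_submod E X Y :
  #|cut E (X :|: Y)| + #|cut E (X :&: Y)| <= #|cut E X| + #|cut E Y|.
Proof.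
rewrite !card_set_in -!big_split /=; apply: leq_sum => e _; rewrite !inE.
by do 4 case: (_ \in _).
Qed.

Lemma cut_posimod E X Y :
  #|cut E (X :\: Y)| + #|cut E (Y :\: X)| <= #|cut E X| + #|cut E Y|.
Proof.
rewrite !card_set_in -!big_split /=; apply: leq_sum => e _; rewrite !inE.
by do 4 case: (_ \in _).
Qed.

Lemma cutP E Y e :
  reflect (e \in E /\ exists x y, [/\ joins e x y, x \in Y & y \notin Y])
          (e \in cut E Y).
Proof.
rewrite inE; apply: (iffP andP) => -[eE].
  move=> eY; split=> //; case e1: (end1 e \in Y) eY => /= e2.
    by exists (end1 e), (end2 e); rewrite /joins !eqxx e1.
  by exists (end2 e), (end1 e); rewrite /joins !eqxx e1 e2 orbT.
case=> x [y [+ xY yY]]; split=> //; move: xY yY.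
by case/orP: p => /andP[/eqP-> /eqP->] -> /negPf->.
Qed.

Lemma disjoint_paths_to E v (I : finType) (src : I -> vertex G) :
    (forall Y, v \notin Y -> #|src @^-1: Y| <= #|cut E Y|) ->
  exists P : I -> {set edge G},
    [/\ forall i, P i \subset E,
        forall i j, i != j -> [disjoint P i & P j] &
        forall i, connect (edge_adj (P i)) (src i) v].
Proof.
move=> cutE.
(* An arc-minimal routable subset of the doubled graph never contains both
   directions of an edge, by submodularity. *)
pose tl (a : edge G * bool) := if a.2 then end1 a.1 else end2 a.1.
pose hd (a : edge G * bool) := if a.2 then end2 a.1 else end1 a.1.
pose rt D := routable tl hd v D src.
have rt0 : rt [set a | a.1 \in E].
  apply/routableP => Y vY; apply: leq_trans (cutE Y vY) _.
  have inj : injective (fun e : edge G => (e, end1 e \in Y)) by move=> ? ? [].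
  rewrite -(card_imset _ inj); apply: subset_leq_card; apply/subsetP => a.
  case/imsetP => e; rewrite !inE => /andP[eE eY] -> /=; rewrite eE /tl /hd /=.
  by case e1: (end1 e \in Y) eY => /=; rewrite e1 => ->.
have [D minD DE] := minset_exists rt0.
case/minsetP: minD => rtD Dmin.
have crit a : a \in D -> exists Y, [/\ v \notin Y, a \in out_arcs tl hd D Y &
    #|out_arcs tl hd D Y| <= #|src @^-1: Y|].
  move=> aD; have : ~~ rt (D :\ a).
    apply/negP => /Dmin /(_ (subD1set _ _)) eD.
    by move: aD; rewrite -eD !inE eqxx.
  rewrite /rt /routable negb_forall => /existsP[Y].
  rewrite negb_imply -ltnNge => /andP[vY lt]; exists Y.
  have eD : out_arcs tl hd (D :\ a) Y = out_arcs tl hd D Y :\ a.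
    by apply/setP => b; rewrite !inE -andbA.
  have := cardsD1 a (out_arcs tl hd D Y); rewrite -eD.
  have /routableP/(_ Y vY) := rtD.
  by case: (a \in out_arcs tl hd D Y); split=> //; lia.
(* Let [X] and [Y] be critical for the two directions of [e]. Deleting [(e, true)] lowers the cut of
   [X], but not those of [Y], [X :|: Y] and [X :&: Y]; submodularity then contradicts the cut
   condition. *)
have one_way e : ~~ (((e, true) \in D) && ((e, false) \in D)).
  apply/negP => /andP[eT eF].
  have [X [vX aX cX]] := crit _ eT; have [Y [vY bY cY]] := crit _ eF.
  move: aX bY; rewrite !inE /tl /hd /= => /and3P[_ e1X e2X] /and3P[_ e2Y e1Y].
  have outI (Z : {set vertex G}) :
      (end1 e \notin Z) || (end2 e \in Z) ->
      out_arcs tl hd (D :\ (e, true)) Z = out_arcs tl hd D Z.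
    move=> Ze; apply/setP => a; rewrite !inE.
    case: eqP => //= ->; rewrite /tl /hd /=.
    by case/orP: Ze => [/negPf->|->]; rewrite ?andbF.
  have := out_arcs_submod tl hd (D :\ (e, true)) X Y.
  rewrite (outI (X :|: Y)) ?(outI (X :&: Y)) ?(outI Y);
    rewrite ?inE ?e2Y ?(negPf e1Y) ?andbF ?orbT //.
  have : #|out_arcs tl hd (D :\ (e, true)) X| < #|out_arcs tl hd D X|.
    apply: proper_card; apply/properP; split.
      by apply/subsetP => a; rewrite !inE -andbA => /andP[].
    by exists (e, true); rewrite !inE ?eT /tl /hd /= ?e1X ?e2X ?eqxx.
  have /routableP rtD' := rtD.
  have := rtD' (X :|: Y); have := rtD' (X :&: Y).
  rewrite !in_setU !in_setI (negPf vX) (negPf vY) preimsetU preimsetI.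
  move=> /(_ isT) + /(_ isT); have := cardsUI (src @^-1: X) (src @^-1: Y).
  lia.
have [P [PD Pdisj Pcon]] := directed_linkage rtD.
exists (fun i => [set a.1 | a in P i]); split=> [i|i j ne|i].
- apply/subsetP => e /imsetP[a /(subsetP (PD i)) aD ->].
  by have := subsetP DE _ aD; rewrite inE.
- rewrite -setI_eq0; apply/eqP/setP => e; rewrite !inE; apply/negP.
  case/andP=> /imsetP[[e1 b1] aP /= ->] /imsetP[[e2 b2] aP' /= e12].
  rewrite -{e2}e12 in aP'; have /negP[] := one_way e1.
  have [eq_b|] := eqVneq b1 b2.
    rewrite -eq_b in aP'; have := disjointFr (Pdisj _ _ ne) aP.
    by rewrite aP'.
  move: (subsetP (PD i) _ aP) (subsetP (PD j) _ aP').
  by case: b1 b2 {aP aP'} => [] [] // -> ->.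
- apply: connect_sub (Pcon i) => x y /existsP[[e b] /and3P[aP /eqP<- /eqP<-]].
  apply: connect1; apply/existsP; exists e; rewrite /joins /tl /hd /=.
  rewrite (_ : e \in _); last by apply/imsetP; exists (e, b).
  by case: b {aP}; rewrite !eqxx ?orbT.
Qed.

End Cuts.

(** * Disjoint tight sets and their territories *)

Section CriticalGraph.

Variables (G : graph) (k : nat) (v : vertex G) (T : {set vertex G}).
Variables (spoke : vertex G -> edge G) (E : {set edge G}).

(** In the application [T] consists of the neighbors of [v], and [E] is an inclusion-minimal edge
    set containing the spokes and satisfying [cut_ge]. Under [cut_ge] the bound [<= k] is an
    equality. *)
Definition tight (Y : {set vertex G}) : bool :=
  [&& v \notin Y, Y :&: T != set0 & #|cut E Y| <= k].

Hypothesis k_ge2 : 2 <= k.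
Hypothesis v_notin_T : v \notin T.
Hypothesis spoke_joins : {in T, forall t, joins (spoke t) v t}.
Hypothesis spoke_E : {in T, forall t, spoke t \in E}.
Hypothesis cut_ge : forall Y : {set vertex G},
  v \notin Y -> Y :&: T != set0 -> k <= #|cut E Y|.
Hypothesis critical : forall e, e \in E -> e \notin spoke @: T ->
  exists2 Y, tight Y & e \in cut E Y.

Implicit Types (X Y : {set vertex G}) (XX : {set {set vertex G}}).

Lemma neq_hub t : t \in T -> t != v.
Proof. by move=> tT; apply: contraNneq v_notin_T => <-. Qed.

Lemma spoke_cut t Y : t \in T -> t \in Y -> v \notin Y -> spoke t \in cut E Y.
Proof.
move=> tT tY vY; apply/cutP; split; first exact: spoke_E.
by exists t, v; split=> //; rewrite joinsC; apply: spoke_joins.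
Qed.

Lemma spoke_inj : {in T &, injective spoke}.
Proof.
move=> s t sT tT eq_st; apply: joins_inj (spoke_joins sT) _.
by rewrite eq_st; apply: spoke_joins.
Qed.

Definition compatible XX Y : Prop :=
  {in XX, forall X, X \subset Y \/ [disjoint X & Y]}.

(* If [X] and [Y] share a vertex of [T], replace [Y] by [Y :|: X], otherwise by
   [Y :\: X]: the cut of [Y] does not grow. *)
Lemma uncross XX Y : trivIset XX -> {in XX, forall X, tight X} -> v \notin Y ->
  exists Y', [/\ v \notin Y', #|cut E Y'| <= #|cut E Y|, Y :&: T \subset Y',
    forall x, x \notin cover XX -> (x \in Y') = (x \in Y) & compatible XX Y'].
Proof.
move=> /trivIsetP triv tXX vY.
suff [Y' [vY' cY' YT out comp]] : exists Y', [/\ v \notin Y',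
    #|cut E Y'| <= #|cut E Y|, Y :&: T \subset Y',
    forall x, x \notin cover XX -> (x \in Y') = (x \in Y) &
    {in enum XX, forall X, X \subset Y' \/ [disjoint X & Y']}].
  by exists Y'; split=> // X XX_X; apply: comp; rewrite mem_enum.
have : {subset enum XX <= XX} by move=> X; rewrite mem_enum.
elim: (enum XX) => [|X s IHs] sXX.
  by exists Y; split=> //; apply: subsetIl.
have [|Y1 [vY1 cY1 YT1 out1 comp1]] := IHs.
  by move=> X' X's; apply: sXX; rewrite inE X's orbT.
have XX_X : X \in XX by apply: sXX; rewrite inE eqxx.
have /and3P[vX XT cX] := tXX _ XX_X.
have disjX X' : X' \in s -> X' = X \/ [disjoint X' & X].
  move=> X's; have [->|ne] := eqVneq X' X; [by left | right].
  by apply: triv => //; apply: sXX; rewrite inE X's orbT.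
have outX x : x \notin cover XX -> x \notin X.
  by apply: contra => xX; apply/bigcupP; exists X.
have [disjT|meetT] := eqVneq (Y1 :&: X :&: T) set0.
- exists (Y1 :\: X); split=> [||||X'].
  + by rewrite inE (negPf vY1) andbF.
  + have XDT : (X :\: Y1) :&: T != set0.
      apply: contraNneq XT => /setP XT0; apply/eqP/setP => x.
      have := XT0 x; have /setP/(_ x) := disjT; rewrite !inE.
      by case: (x \in X) (x \in Y1) (x \in T) => [] [] [].
    (* Since [X :\: Y1] still meets [T], its cut is at least as large as that of [X], and
       posimodularity bounds the cut of [Y1 :\: X]. *)
    have := cut_posimod E Y1 X; have := @cut_ge (X :\: Y1).
    rewrite inE (negPf vX) andbF => /(_ isT XDT).
    by clear -cX cY1; lia.
  + apply/subsetP => x xYT; rewrite inE (subsetP YT1 _ xYT) andbT.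
    have /setP/(_ x) := disjT; rewrite !inE (subsetP YT1 _ xYT) /=.
    by case/setIP: xYT => _ ->; rewrite andbT => ->.
  + by move=> x xX; rewrite inE outX //= out1.
  + rewrite inE => /predU1P[->|X's].
      by right; rewrite disjoint_sym disjoints_subset subsetDr.
    case: (disjX _ X's) => [->|dX].
      by right; rewrite disjoint_sym disjoints_subset subsetDr.
    case: (comp1 _ X's) => [sub|dis]; [left | right].
      by rewrite subsetD sub.
    by apply: disjointWr dis; apply: subsetDl.
- exists (Y1 :|: X); split=> [||||X'].
  + by rewrite inE negb_or vY1.
  + have := cut_submod E Y1 X; have := @cut_ge (Y1 :&: X).
    rewrite inE (negPf vY1) /= => /(_ isT meetT).
    by clear -cX cY1; lia.
  + exact: subset_trans YT1 (subsetUl _ _).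
  + by move=> x xX; rewrite inE (negPf (outX _ xX)) orbF out1.
  + rewrite inE => /predU1P[->|X's]; first by left; apply: subsetUr.
    case: (disjX _ X's) => [->|dX]; first by left; apply: subsetUr.
    case: (comp1 _ X's) => [sub|dis]; [left | right].
      exact: subset_trans sub (subsetUl _ _).
    by rewrite -setI_eq0 setIUr setU_eq0 !setI_eq0 dis.
Qed.

(** Take a packing with the largest cover. A non-spoke edge with no covered end would leave a tight
    set; uncrossing this set and letting it absorb the members inside it would enlarge the cover. *)
Lemma exists_tight_packing :
  exists XX, [/\ trivIset XX, {in XX, forall X, tight X} &
    forall e, e \in E -> e \notin spoke @: T ->
      (end1 e \in cover XX) || (end2 e \in cover XX)].
Proof.
pose packing XX := trivIset XX && [forall (X | X \in XX), tight X].
have p0 : packing set0.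
  apply/andP; split; first by apply/trivIsetP => X Y; rewrite inE.
  by apply/forall_inP => X; rewrite inE.
case: (arg_maxnP (fun XX => #|cover XX|) p0) => XX /andP[triv /forall_inP tXX].
move=> maxXX; exists XX; split=> // e eE nsp; apply/negPn/negP.
rewrite negb_or => /andP[e1 e2].
have [Y /and3P[vY YT cY] /cutP[_ [x [y [exy xY _]]]]] := critical eE nsp.
have xXX : x \notin cover XX.
  by case/orP: exy => /andP[/eqP h1 /eqP h2]; rewrite -?h1 -?h2.
have [Y' [vY' cY' YT' out comp]] := uncross triv tXX vY.
have tY' : tight Y'.
  rewrite /tight vY' (leq_trans cY') // andbT.
  have /set0Pn[z zYT] := YT; apply/set0Pn; exists z.
  by rewrite inE (subsetP YT' _ zYT); case/setIP: zYT.
pose XX' := Y' |: [set X in XX | [disjoint X & Y']].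
have pXX' : packing XX'.
  apply/andP; split.
    apply/trivIsetP => A B; rewrite !inE.
    case/predU1P=> [->|/andP[AX dA]] /predU1P[->|/andP[BX dB]] //.
    - by rewrite eqxx.
    - by rewrite disjoint_sym.
    - by have /trivIsetP := triv; apply.
  apply/forall_inP => X; rewrite !inE => /predU1P[->//|/andP[XX_X _]].
  exact: tXX.
have := maxXX _ pXX'; apply/negP; rewrite -ltnNge; apply: proper_card.
apply/properP; split; last first.
  exists x => //; apply/bigcupP; exists Y'; first by rewrite !inE eqxx.
  by rewrite out.
apply/subsetP => z /bigcupP[X XX_X zX]; apply/bigcupP.
case: (comp _ XX_X) => [/subsetP sub|dis].
  by exists Y'; [rewrite !inE eqxx | apply: sub].
by exists X; rewrite // !inE XX_X dis orbT.
Qed.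

Section Packing.

Variable XX : {set {set vertex G}}.
Hypothesis XX_triv : trivIset XX.
Hypothesis XX_tight : {in XX, forall X, tight X}.
Hypothesis XX_cover : forall e, e \in E -> e \notin spoke @: T ->
  (end1 e \in cover XX) || (end2 e \in cover XX).

Definition free (z : vertex G) : bool := (z != v) && (z \notin cover XX).

(** An edge with both ends free would be a spoke by [XX_cover], but spokes end at [v]. *)
Lemma joins_free e y z : e \in E -> joins e y z -> free y -> ~~ free z.
Proof.
move=> eE eyz /andP[yv yX]; apply/negP => /andP[zv zX].
have [/imsetP[t tT ee]|/(XX_cover eE)] := boolP (e \in spoke @: T); last first.
  by case/orP: eyz => /andP[/eqP-> /eqP->]; rewrite (negPf yX) (negPf zX).
have := spoke_joins tT; rewrite -ee /joins.
case/orP: eyz => /andP[/eqP-> /eqP->];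
  by rewrite (negPf yv) (negPf zv) andbF.
Qed.

Lemma free_cut_inj e y z : free y -> free z ->
  e \in cut E [set y] -> e \in cut E [set z] -> y = z.
Proof.
move=> fy fz /cutP[eE [x [x' [exx' xy x'y]]]] /cutP[_ [w [w' [eww' wz w'z]]]].
move/set1P: xy => ex; move/set1P: wz => ew; subst x w.
apply/eqP; apply: contraTT fz => ne.
suff -> : z = x' by exact: joins_free eE exx' fy.
move: exx' eww' ne; rewrite /joins => /orP[] /andP[/eqP-> /eqP->];
  by case/orP=> /andP[/eqP-> /eqP->] //; rewrite eqxx.
Qed.

Lemma card_XX_cut X : X \in XX -> #|cut E X| = k.
Proof.
move=> /XX_tight/and3P[vX XT cX]; apply/eqP; rewrite eqn_leq cX.
exact: cut_ge.
Qed.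

Lemma card_bigcup_cut (S : {set {set vertex G}}) : S \subset XX ->
  #|\bigcup_(X in S) cut E X| <= #|S| * k.
Proof.
move=> /subsetP SXX; apply: leq_trans (card_bigcup_le _ _) _.
rewrite -sum_nat_const; apply: leq_sum => X XS.
by rewrite card_XX_cut ?SXX.
Qed.

(** Each tight set contains at most [k] vertices of [T], since their spokes leave it. A vertex of
    [T] outside the cover has a second edge, as [k >= 2], and this edge leads into a tight set.
    Distinct vertices give distinct edges, and at most [k * #|XX|] edges leave the tight sets. *)
Lemma card_T_le : #|T| <= 2 * k * #|XX|.
Proof.
have -> : 2 * k * #|XX| = #|XX| * k + #|XX| * k by lia.
rewrite -(cardsID (cover XX) T); apply: leq_add.
  rewrite /cover big_distrr /= -sum_nat_const.
  apply: leq_trans (card_bigcup_le _ _) _; apply: leq_sum => X XX_X.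
  rewrite -(card_XX_cut XX_X) -(card_in_imset (f := spoke)); last first.
    by move=> s t /setIP[sT _] /setIP[tT _]; apply: spoke_inj.
  apply: subset_leq_card; apply/subsetP => e /imsetP[t /setIP[tT tX] ->].
  by apply: spoke_cut => //; have /and3P[] := XX_tight XX_X.
pose g z := odflt (spoke z) [pick e in cut E [set z] | e != spoke z].
have gP z : z \in T :\: cover XX ->
    [/\ free z, g z \in cut E [set z] & g z \in \bigcup_(X in XX) cut E X].
  rewrite inE => /andP[zX zT]; have fz : free z by rewrite /free neq_hub.
  have cz : k <= #|cut E [set z]|.
    apply: cut_ge; first by rewrite inE eq_sym neq_hub.
    by apply/set0Pn; exists z; rewrite !inE eqxx.
  rewrite /g; case: pickP => [e /andP[ez ne]|none] /=; last first.
    suff : #|cut E [set z]| <= #|[set spoke z]| by rewrite cards1; lia.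
    apply: subset_leq_card; apply/subsetP => e ez; rewrite inE.
    by have := none e; rewrite /= ez => /negbFE.
  split=> //; have /cutP[eE [x [y [exy]]]] := ez; rewrite !inE => /eqP xz yz.
  have nsp : e \notin spoke @: T.
    apply/imsetP => -[t tT ee]; subst x; have := spoke_joins tT.
    have := neq_hub zT.
    have tz : t != z by apply: contraNneq ne => <-; rewrite ee.
    move: exy tz; rewrite -ee /joins => /orP[] /andP[/eqP-> /eqP->];
      by move=> /negPf tz /negPf zv; rewrite zv (eq_sym z t) tz ?andbF.
  have : y \in cover XX.
    have := XX_cover eE nsp; subst x.
    by case/orP: exy => /andP[/eqP-> /eqP->]; rewrite (negPf zX) ?orbF.
  case/bigcupP => X XX_X yX; apply/bigcupP; exists X => //.
  apply/cutP; split=> //; exists y, x; split=> //; first by rewrite /joins orbC.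
  by subst x; apply: contra zX => zX; apply/bigcupP; exists X.
apply: leq_trans (card_bigcup_cut (subxx _)).
rewrite -(card_in_imset (f := g)); last first.
  move=> y z /gP[fy gy _] /gP[fz gz _] gyz; rewrite -gyz in gz.
  exact: free_cut_inj gy gz.
by apply: subset_leq_card; apply/subsetP => e /imsetP[z /gP[_ _ ?] ->].
Qed.

(* The label classes at a free vertex act as vertices of bounded degree obtained
   by splitting it. *)
Lemma exists_edge_labels K : 0 < K ->
  exists L : edge G -> (vertex G * nat) + edge G,
    {in E, forall e, #|[set e' in E | L e' == L e]| <= 2 * K} /\
    forall z, free z -> {in cut E [set z], forall e,
      [set e' in E | L e' == L e] \subset cut E [set z] /\
      (K <= #|[set e' in E | L e' == L e]| \/
       [set e' in E | L e' == L e] = cut E [set z])}.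
Proof.
move=> K0.
have /fin_all_exists[b hb] := fun z => exists_block_labels (cut E [set z]) K0.
pose free_end e := [pick z | free z && (e \in cut E [set z])].
have free_endE z e : free z -> e \in cut E [set z] -> free_end e = Some z.
  move=> fz ez; rewrite /free_end; case: pickP => [y /andP[fy ey]|/(_ z)].
    by rewrite (free_cut_inj fy fz ey ez).
  by rewrite /= fz ez.
(* An edge of [E] with free end [z] is labelled by [z] and its block there; every other edge forms a
   class of its own. *)
pose L e := if free_end e is Some z then inl (z, b z e) else inr e.
have LE z e : free z -> e \in cut E [set z] ->
    [set e' in E | L e' == L e] = [set e' in cut E [set z] | b z e' == b z e].
  move=> fz ez; apply/setP => e'; rewrite [in LHS]inE [in RHS]inE.
  have -> : L e = inl (z, b z e) by rewrite /L (free_endE z).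
  apply/andP/andP => -[e'E].
    rewrite /L; case E': (free_end e') => [y|] // /eqP[yz bb].
    subst y; rewrite bb; split=> //.
    by move: E'; rewrite /free_end; case: pickP => // y /andP[_ ?] [<-].
  move=> /eqP bb; rewrite /L (free_endE z) // bb eqxx; split=> //.
  exact: subsetP (cut_sub E [set z]) _ e'E.
exists L; split=> [e eE|z fz e ez]; last first.
  rewrite (LE z) //; split; last by case: (hb z e ez).
  by apply/subsetP => e'; rewrite inE => /andP[].
case Ee: (free_end e) => [z|].
  move: Ee; rewrite /free_end; case: pickP => // y /andP[fy ey] _.
  by rewrite (LE y) //; case: (hb y e ey).
apply: (@leq_trans #|[set e]|); last by rewrite cards1; clear -K0; lia.
apply: subset_leq_card; apply/subsetP => e'; rewrite !inE => /andP[_].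
by rewrite /L Ee; case: (free_end e') => // /eqP[->].
Qed.

(** * Linked tight sets and their territories *)

Section Territories.

Variable L : edge G -> (vertex G * nat) + edge G.
Hypothesis L_small :
  {in E, forall e, #|[set e' in E | L e' == L e]| <= 2 * (k * k)}.
Hypothesis L_free : forall z, free z -> {in cut E [set z], forall e,
  [set e' in E | L e' == L e] \subset cut E [set z] /\
  (k * k <= #|[set e' in E | L e' == L e]| \/
   [set e' in E | L e' == L e] = cut E [set z])}.

Definition linked X X' : bool :=
  [&& X \in XX, X' \in XX &
    [exists e in cut E X, [exists e' in cut E X', L e == L e']]].

(** The radius is [k.-1] because a cluster grown from [X] in [k.-1] rounds, enough to reach [k]
    members, stays within that distance. *)
Definition territory X : {set edge G} :=
  [set e in E | [exists X' in ball linked k.-1 X,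
    (X' \in XX) && [exists e' in cut E X', L e' == L e]]].

Lemma linked_sym : symmetric linked.
Proof.
move=> X X'; rewrite /linked andbCA; congr [&& _, _ & _].
by apply/existsP/existsP => -[e /andP[eX /existsP[e' /andP[eX' /eqP LL]]]];
  exists e'; rewrite eX'; apply/existsP; exists e; rewrite eX LL eqxx.
Qed.

Lemma linkedI X X' e e' : X \in XX -> X' \in XX ->
  e \in cut E X -> e' \in cut E X' -> L e = L e' -> linked X X'.
Proof.
move=> XX_X XX_X' eX eX' LL; rewrite /linked XX_X XX_X'.
apply/existsP; exists e; rewrite eX; apply/existsP; exists e'.
by rewrite eX' LL eqxx.
Qed.

Lemma territoryI X X' e e' : X' \in ball linked k.-1 X -> X' \in XX ->
  e' \in cut E X' -> e \in E -> L e' = L e -> e \in territory X.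
Proof.
move=> X'X XX_X' eX' eE LL; rewrite inE eE; apply/existsP; exists X'.
by rewrite X'X XX_X'; apply/existsP; exists e'; rewrite eX' LL eqxx.
Qed.

(** The bound is [k * (2 * (k * k)) * 2]: the edges leaving [X], the edges in the class of each, and
    the blocks at the two ends of each of these. *)
Lemma card_nbhd_linked X : #|nbhd linked X| <= 4 * k ^ 3.
Proof.
have [XX_X|nX] := boolP (X \in XX); last first.
  suff -> : nbhd linked X = [set X].
    by rewrite cards1 muln_gt0 expn_gt0; lia.
  by apply/setP => X'; rewrite !inE /linked (negPf nX) orbF eq_sym.
pose F e := \bigcup_(e' in [set e' in E | L e' == L e])
  [set pblock XX (end1 e'); pblock XX (end2 e')].
have sub : nbhd linked X \subset \bigcup_(e in cut E X) F e.
  have inF X' e e' : X' \in XX -> e' \in cut E X' -> L e = L e' -> X' \in F e.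
    move=> XX_X' eX' LL; apply/bigcupP; exists e'.
      by rewrite inE (subsetP (cut_sub _ _) _ eX') LL eqxx.
    have [x [y [exy xX' _]]] := proj2 (elimT (cutP _ _ _) eX').
    have pX' := def_pblock XX_triv XX_X' xX'.
    by rewrite !inE; case/orP: exy => /andP[/eqP-> /eqP->];
      rewrite pX' eqxx ?orbT.
  apply/subsetP => X'; rewrite inE => /predU1P[<-|/and3P[_ XX_X']].
    have /card_gt0P[e eX] : 0 < #|cut E X| by rewrite card_XX_cut //; lia.
    by apply/bigcupP; exists e => //; apply: inF eX _.
  case/existsP=> e /andP[eX /existsP[e' /andP[eX' /eqP LL]]].
  by apply/bigcupP; exists e => //; apply: inF eX' LL.
apply: leq_trans (subset_leq_card sub) _.
apply: leq_trans (card_bigcup_le _ _) _.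
apply: (@leq_trans (\sum_(e in cut E X) 4 * (k * k))); last first.
  by rewrite sum_nat_const card_XX_cut // !expnS; lia.
apply: leq_sum => e /(subsetP (cut_sub _ _)) eE.
apply: leq_trans (card_bigcup_le _ _) _.
apply: (@leq_trans (\sum_(e' in [set e' in E | L e' == L e]) 2)).
  by apply: leq_sum => e' _; rewrite cards2; case: (_ == _).
by rewrite sum_nat_const; have := L_small eE; lia.
Qed.

(** A common edge links a member within [k.-1] of [X] to one within [k.-1] of [X'], so the distance
    is at most [k.-1 + 1 + k.-1]. *)
Lemma territory_meet X X' e : e \in territory X -> e \in territory X' ->
  X' \in ball linked (2 * k).-1 X.
Proof.
rewrite !inE => /andP[_ /existsP[X1 /and3P[X1X XX1]]] /existsP[e1].
move=> /andP[eX1 L1] /andP[_ /existsP[X2 /and3P[X2X' XX2]]] /existsP[e2].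
move=> /andP[eX2 L2].
have -> : (2 * k).-1 = k.-1.+1 + k.-1 by clear -k_ge2; lia.
apply: (@ball_add _ _ _ _ _ X2); last by apply: ball_sym linked_sym X2X'.
apply: ball_step X1X _; rewrite (@linkedI _ _ e1 e2) ?orbT //.
by rewrite (eqP L1) (eqP L2).
Qed.

Definition rep X : vertex G := odflt v [pick t in X :&: T].

Lemma repP X : X \in XX -> rep X \in X /\ rep X \in T.
Proof.
move=> /XX_tight/and3P[_ /set0Pn[t tXT] _]; rewrite /rep.
by case: pickP => [s /setIP[]|/(_ t)] //=; rewrite tXT.
Qed.

Lemma XX_inj X X' x : X \in XX -> X' \in XX -> x \in X -> x \in X' -> X = X'.
Proof.
move=> XX_X XX_X' xX xX'.
by rewrite -(def_pblock XX_triv XX_X xX) (def_pblock XX_triv XX_X' xX').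
Qed.

Lemma free_notin X z : free z -> X \in XX -> z \notin X.
Proof.
move=> /andP[_ zX] XX_X; apply: contra zX => zX.
by apply/bigcupP; exists X.
Qed.

Lemma free_cut z y e : free z -> e \in E -> joins e z y -> z != y ->
  e \in cut E [set z].
Proof.
move=> fz eE ezy ne; apply/cutP; split=> //; exists z, y.
by rewrite !inE eqxx eq_sym.
Qed.

(* Grow the cluster of packing members reachable from [X] inside [Y].  If it
   has [k] members, their spokes suffice.  Otherwise either some free vertex
   of [Y] sends a large class of edges, too many to be absorbed by the
   cluster, or the cluster together with the adjacent free vertices of [Y]
   is a set whose whole cut lies in that of [Y]. *)
Lemma territory_cut X Y : X \in XX -> compatible XX Y -> v \notin Y ->
  X \subset Y -> k <= #|cut E Y :&: territory X|.
Proof.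
move=> XX_X comp vY XY.
pose J := [set X' in XX | X' \subset Y].
have inJ X' y : X' \in XX -> y \in X' -> y \in Y -> X' \in J.
  move=> XX_X' yX' yY; rewrite inE XX_X'.
  case: (comp _ XX_X') => // /disjointFr /(_ yX').
  by rewrite yY.
have freeVJ y : y \in Y -> free y \/ exists2 X', X' \in J & y \in X'.
  move=> yY; have yv : y != v by apply: contraNneq vY => <-.
  have [|yX] := boolP (y \in cover XX); last by left; rewrite /free yv.
  by case/bigcupP => X' XX_X' yX'; right; exists X' => //; apply: inJ yX' yY.
pose f B := B :|: [set X' in J | [exists X1 in B, linked X1 X']].
have fsub (B : {set {set vertex G}}) : B \subset f B by apply: subsetUl.
have CJ m : iter m f [set X] \subset J.
  elim: m => [|m IHm] /=; first by rewrite sub1set inE XX_X.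
  by rewrite subUset IHm; apply/subsetP => X'; rewrite inE => /andP[].
have CXX m X' : X' \in iter m f [set X] -> X' \in XX /\ X' \subset Y.
  by move=> /(subsetP (CJ m)); rewrite inE => /andP[].
have Cball m X' : X' \in iter m f [set X] -> X' \in ball linked m X.
  elim: m X' => [|m IHm] X' //=; rewrite 2!inE => /orP[/IHm X'X|].
    by apply: ball_step X'X _; rewrite eqxx.
  case/andP=> _ /existsP[X1 /andP[/IHm X1X lk]].
  by apply: ball_step X1X _; rewrite lk orbT.
(* With [q = k.-1], either the cluster reaches [k] members or it stabilises with fewer. *)
have [|big|[m [mk cC closed]]] := @iter_growth _ f [set X] k.-1 fsub _.
- by apply/set0Pn; exists X; rewrite inE.
- apply: (@leq_trans #|[set spoke (rep X') | X' in iter k.-1 f [set X]]|).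
    rewrite card_in_imset; first by clear -big; lia.
    move=> X1 X2 /CXX[XX1 _] /CXX[XX2 _].
    have [r1 t1] := repP XX1; have [r2 t2] := repP XX2.
    move=> /(spoke_inj t1 t2) eq_rep.
    by apply: XX_inj XX1 XX2 r1 _; rewrite eq_rep.
  apply: subset_leq_card; apply/subsetP => e /imsetP[X' CX' ->].
  have [XX' X'Y] := CXX _ _ CX'; have [r t] := repP XX'.
  have vX' : v \notin X' by apply: contra vY; apply: (subsetP X'Y).
  rewrite inE (spoke_cut t (subsetP X'Y _ r) vY) /=.
  apply: territoryI (Cball _ _ CX') XX' (spoke_cut t r vX') _ (erefl _).
  exact: spoke_E.
set C := iter m f [set X] in closed cC.
have terrC X1 e e' : X1 \in C -> e' \in cut E X1 -> e \in E -> L e' = L e ->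
    e \in territory X.
  move=> CX1; apply: territoryI; last by have [] := CXX _ _ CX1.
  by apply: subsetP (ball_mono _ _ (ltnW mk)) _ (Cball _ _ CX1).
have closedC X1 X2 e1 e2 : X1 \in C -> X2 \in J -> e1 \in cut E X1 ->
    e2 \in cut E X2 -> L e1 = L e2 -> X2 \in C.
  move=> CX1 JX2 eX1 eX2 LL; rewrite -closed inE [X in _ || X]inE JX2.
  apply/orP; right; apply/existsP; exists X1; rewrite CX1.
  have [XX1 _] := CXX _ _ CX1; move: JX2; rewrite inE => /andP[XX2 _].
  exact: linkedI XX1 XX2 eX1 eX2 LL.
have cutJ X2 z y e : free z -> e \in E -> joins e z y -> X2 \in J ->
    y \in X2 -> e \in cut E X2.
  move=> fz eE ezy; rewrite inE => /andP[XX2 _] yX2.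
  apply/cutP; split=> //; exists y, z; rewrite joinsC ezy yX2.
  by split=> //; apply: free_notin.
pose touches z e := [&& free z, z \in Y, e \in cut E [set z] &
  [exists X1 in C, e \in cut E X1]].
(* Within [Y], an edge at [z] in the class of an edge leaving the cluster must lead into the
   cluster: free vertices are not adjacent, and the cluster is closed under links in [J]. *)
have exitP z e X1 e0 y : free z -> z \in Y -> X1 \in C -> e0 \in cut E X1 ->
    L e0 = L e -> e \in E -> joins e z y -> y \in Y ->
    exists2 X2, X2 \in C & y \in X2.
  move=> fz zY CX1 eX1 LL eE ezy yY; case: (freeVJ y yY) => [fy|[X2 JX2 yX2]].
    by have := joins_free eE ezy fz; rewrite fy.
  exists X2 => //; apply: (closedC _ _ _ _ CX1 JX2 eX1 _ LL).
  exact: cutJ fz eE ezy JX2 yX2.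
have [/existsP[z /existsP[e /andP[]]]|noBig] := boolP [exists z, exists e,
    touches z e && (k * k <= #|[set e' in E | L e' == L e]|)].
  case/and4P=> fz zY ez /existsP[X1 /andP[CX1 eX1]] bigQ.
  set Q := [set e' in E | L e' == L e] in bigQ.
  have [Qz _] := L_free fz ez; rewrite -/Q in Qz.
  have cU : #|\bigcup_(X' in C) cut E X'| <= #|C| * k.
    apply: card_bigcup_cut; apply/subsetP => X' /CXX[]; tauto.
  (* The cuts of the cluster contain at most [k.-1 * k] edges, so at least [k] edges of [Q] remain.
     Each of them leaves [Y]. *)
  apply: (@leq_trans #|Q :\: \bigcup_(X' in C) cut E X'|).
    have := cardsD Q (\bigcup_(X' in C) cut E X').
    have := subset_leq_card (subsetIr Q (\bigcup_(X' in C) cut E X')).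
    have : #|C| * k <= k.-1 * k by rewrite leq_mul2r cC orbT.
    have : k * k = k.-1 * k + k by rewrite -mulSnr prednK //; clear -k_ge2; lia.
    by clear -cU bigQ; lia.
  apply: subset_leq_card; apply/subsetP => e' /setDP[Qe' nC].
  have := Qe'; rewrite inE => /andP[e'E /eqP LL].
  rewrite inE (terrC X1 e' e) // andbT.
  have /cutP[_ [x [y [+ /set1P xz yz]]]] := subsetP Qz _ Qe'; subst x => ezy.
  apply/cutP; split=> //; exists z, y; split=> //; apply/negP => yY.
  have [X2 CX2 yX2] := exitP z e' X1 e y fz zY CX1 eX1 (esym LL) e'E ezy yY.
  case/negP: nC; apply/bigcupP; exists X2 => //.
  by apply: cutJ fz e'E ezy _ yX2; apply: (subsetP (CJ m)).
(* Now the class of an edge from a free vertex of [Y] to the cluster is the whole cut of that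
   vertex. With these vertices added to the cluster, every edge leaving [Y'] leaves [Y] and lies in
   the territory. *)
pose Y' := cover C :|: [set z | [exists e, touches z e]].
have Y'Y : Y' \subset Y.
  apply/subsetP => z /setUP[/bigcupP[X1 /CXX[_ /subsetP XY1] /XY1]//|].
  by rewrite inE => /existsP[e /and4P[]].
apply: (@leq_trans #|cut E Y'|).
  apply: cut_ge; first by apply: contra vY; apply: (subsetP Y'Y).
  have [rX tX] := repP XX_X; apply/set0Pn; exists (rep X); rewrite !inE tX andbT.
  apply/orP; left; apply/bigcupP; exists X => //.
  by rewrite /C; elim: (m) => [|i IHi] /=; rewrite inE // IHi.
apply: subset_leq_card; apply/subsetP => e /cutP[eE [a [b [eab aY' bY']]]].
have bC X2 : X2 \in C -> b \notin X2.
  by move=> CX2; apply: contra bY' => bX2; apply/setUP; left;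
    apply/bigcupP; exists X2.
suff [bY eT] : b \notin Y /\ e \in territory X.
  rewrite inE eT andbT; apply/cutP; split=> //; exists a, b; split=> //.
  exact: (subsetP Y'Y).
case/setUP: aY' => [/bigcupP[X1 CX1 aX1]|].
  have eX1 : e \in cut E X1.
    by apply/cutP; split=> //; exists a, b; split=> //; apply: bC.
  split; last exact: terrC CX1 eX1 eE (erefl _).
  apply/negP => bY; case: (freeVJ b bY) => [fb|[X2 JX2 bX2]].
    case/negP: bY'; apply/setUP; right; rewrite inE; apply/existsP; exists e.
    rewrite /touches fb bY (@free_cut b a) //=; last 2 first.
    - by rewrite joinsC.
    - by apply: contraNneq (bC _ CX1) => ->.
    by apply/existsP; exists X1; rewrite CX1.
  have [XX1 _] := CXX _ _ CX1; have := JX2; rewrite inE => /andP[XX2 _].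
  have eX2 : e \in cut E X2.
    apply/cutP; split=> //; exists b, a; rewrite joinsC; split=> //.
    apply: contra (bC _ CX1) => aX2.
    by rewrite (XX_inj XX1 XX2 aX1 aX2).
  by have := bC _ (closedC _ _ _ _ CX1 JX2 eX1 eX2 (erefl _)); rewrite bX2.
rewrite inE => /existsP[e0 te0]; have /and4P[fa aY ea] := te0.
case/existsP=> X1 /andP[CX1 eX1].
have ne : a != b.
  apply: contraNneq bY' => <-; apply/setUP; right; rewrite inE.
  by apply/existsP; exists e0.
have LL : L e0 = L e.
  have [_ [bigQ|QE]] := L_free fa ea.
    by case/negP: noBig; apply/existsP; exists a; apply/existsP; exists e0;
      rewrite te0.
  have : e \in cut E [set a] by apply: free_cut eab ne.
  by rewrite -QE inE => /andP[_ /eqP].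
split; last exact: terrC CX1 eX1 eE LL.
apply/negP => bY.
have [X2 CX2 bX2] := exitP a e X1 e0 b fa aY CX1 eX1 LL eE eab bY.
by have := bC _ CX2; rewrite bX2.
Qed.

(** Members more than [(2 * k).-1] links apart have disjoint territories. Uncrossing [Y] keeps the
    representatives inside, so each contributes [k] edges of its own territory. *)
Lemma exists_spread_packing n : n * (4 * k ^ 3) ^ (2 * k).-1 <= #|XX| ->
  exists2 I : {set {set vertex G}}, I \subset XX & #|I| = n /\
    forall Y, v \notin Y -> #|[set X in I | rep X \in Y]| * k <= #|cut E Y|.
Proof.
move=> n_le.
pose R := [rel X X' | X' \in ball linked (2 * k).-1 X].
have [|||X|I IXX [cardI Isep]] := exists_spread_subset (R := R) _ _ _ _ n_le.
- by rewrite expn_gt0 muln_gt0 expn_gt0; clear -k_ge2; lia.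
- by move=> X; apply: ball_refl.
- by move=> X X'; apply/idP/idP; apply: ball_sym linked_sym.
- have -> : [set X' | R X X'] = ball linked (2 * k).-1 X.
    by apply/setP => X'; rewrite inE.
  by apply: card_ball => X'; apply: card_nbhd_linked.
exists I => //; split=> // Y vY.
have [Y' [vY' cY' YT _ comp]] := uncross XX_triv XX_tight vY.
apply: leq_trans cY'.
apply: (@leq_trans (\sum_(X in [set X in I | rep X \in Y])
                      #|cut E Y' :&: territory X|)).
  rewrite -sum_nat_const; apply: leq_sum => X; rewrite inE => /andP[IX rY].
  have XX_X := subsetP IXX _ IX; have [rX tX] := repP XX_X.
  apply: territory_cut => //; case: (comp _ XX_X) => // /disjointFr /(_ rX).
  by rewrite (subsetP YT) // inE rY.
apply: sum_card_le => [X _|X X' ]; first exact: subsetIl.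
rewrite !inE => /andP[IX _] /andP[IX' _] e /setIP[_ eX] /setIP[_ eX'].
by apply: Isep => //; apply: territory_meet eX eX'.
Qed.

End Territories.

End Packing.

End CriticalGraph.

(** * The immersion *)

Section Walks.

Variable G : graph.
Implicit Types (P Q : {set edge G}) (x y s v : vertex G).

Lemma edge_adj_connectC P x y :
  connect (edge_adj P) x y = connect (edge_adj P) y x.
Proof. exact: sym_connect_sym (@edge_adj_sym G P) x y. Qed.

Lemma edge_adjS P Q : P \subset Q ->
  subrel (connect (edge_adj P)) (connect (edge_adj Q)).
Proof.
move=> /subsetP PQ; apply: connect_sub => x y /existsP[e /andP[/PQ eQ exy]].
by apply: connect1; apply/existsP; exists e; rewrite eQ.
Qed.

Lemma connect_cross P (Y : {set vertex G}) x y :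
  connect (edge_adj P) x y -> x \in Y -> y \notin Y -> exists e, e \in cut P Y.
Proof.
move=> con xY yY; apply/existsP; apply: contraNT yY => /existsPn none.
suff /closed_connect/(_ _ _ con) <- : closed (edge_adj P) (mem Y) by [].
apply: intro_closed; first exact: sym_connect_sym (@edge_adj_sym G P).
move=> a b /existsP[e /andP[eP eab]] aY; apply: contraR (none e) => bY.
by apply/cutP; split=> //; exists a, b.
Qed.

Lemma component_subproof P v e :
  e \in [set e in P | connect (edge_adj P) v (end1 e)] ->
  (end1 e \in [set x | connect (edge_adj P) v x]) &&
  (end2 e \in [set x | connect (edge_adj P) v x]).
Proof.
rewrite !inE => /andP[eP ve]; rewrite ve; apply: connect_trans ve _.
by apply: connect1; apply/existsP; exists e; rewrite eP /joins !eqxx.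
Qed.

(** A linkage yields only edge sets connecting two vertices; passing to the component of [v]
    discards stray edges and ensures connectedness. *)
Definition component P v : subgraph G := Subgraph (@component_subproof P v).

Lemma component_connected P v : connected (component P v).
Proof.
have sym : connect_sym (adjacent_in (component P v)).
  apply: sym_connect_sym => x y.
  by apply: eq_existsb => e; rewrite joinsC.
split; first by apply/set0Pn; exists v; rewrite inE.
have from_v x : x \in verts (component P v) ->
    connect (adjacent_in (component P v)) v x.
  rewrite inE => /connectP[p vp ->].
  have : connect (edge_adj P) v v by [].
  move: {1 3 5 6}v vp => y; elim: p y => //= z p IHp y /andP[yz zp] vy.
  apply: (@connect_trans _ _ z); last first.
    exact: IHp zp (connect_trans vy (connect1 yz)).
  case/existsP: yz => e /andP[eP eyz].
  apply: connect1; apply/existsP; exists e; rewrite eyz andbT inE eP.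
  case/orP: eyz => /andP[/eqP e1 /eqP e2]; rewrite e1 //.
  apply: connect_trans vy (connect1 _).
  by apply/existsP; exists e; rewrite eP /joins e1 e2 !eqxx orbT.
move=> x y /from_v vx /from_v vy.
by apply: connect_trans vy; rewrite sym.
Qed.

(** Puts a simple path into the list format of [is_cycle]; the last clause lets it be closed up by
    one further entry. The edges are distinct because each has an end that the rest of the path
    avoids. *)
Lemma walk_edges Q x q : path (edge_adj Q) x q -> uniq (x :: q) ->
  exists c : seq (vertex G * edge G), [/\ [seq d.1 | d <- c] = belast x q,
    uniq [seq d.2 | d <- c],
    forall e, e \in [seq d.2 | d <- c] ->
      [/\ e \in Q, end1 e \in x :: q & end2 e \in x :: q] &
    forall d0 dl, joins d0.2 d0.1 x -> dl.1 = last x q ->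
      path [rel d d' | joins d.2 d.1 d'.1] d0 (rcons c dl)].
Proof.
elim: q x => [|z q IHq] x.
  move=> _ _; exists [::]; split=> // d0 dl; rewrite /= andbT => ? ->.
  by [].
case/andP=> /existsP[e /andP[eQ exz]] zq; rewrite cons_uniq => /andP[xzq uzq].
have [c [c1 uc2 cQ cpath]] := IHq z zq uzq.
exists ((x, e) :: c); split=> /=; first by rewrite c1.
- rewrite uc2 andbT; apply: contra xzq => /cQ[_ e1 e2].
  by case/orP: exz => /andP[/eqP h1 /eqP h2]; [rewrite -h1 | rewrite -h2].
- move=> e'; rewrite inE => /predU1P[->|/cQ[e'Q e1 e2]].
    by case/orP: exz => /andP[/eqP-> /eqP->]; rewrite !inE !eqxx ?orbT.
  by split=> //; rewrite inE ?e1 ?e2 orbT.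
- move=> d0 dl /= -> dlE; rewrite /=; exact: cpath.
Qed.

(** Let [e], from [s] to [y], be the first edge of a simple path in [P1]. The rest of that path and
    the connection in [P2] lead from [y] back to [s] without [e]; a simple path extracted from them
    closes up with [e]. *)
Lemma cycle_of_two_paths P1 P2 s v : s != v -> [disjoint P1 & P2] ->
    connect (edge_adj P1) s v -> connect (edge_adj P2) s v ->
  contains_cycle_through (component (P1 :|: P2) v) s.
Proof.
move=> sv dis /connectP[p0 sp0]; case/shortenP: sp0 => p sp up _ vE con2.
case: p sp up vE => [_ _ /= vs|y p]; first by rewrite vs eqxx in sv.
rewrite [path _ _ _]/= [uniq _]/= => /andP[/existsP[e /andP[eP1 esy]] yp].
case/andP=> syp _ /= vE.
pose Q := (P1 :|: P2) :\ e.
have yv : connect (edge_adj Q) y v.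
  apply/connectP; exists p => //; apply: sub_in_path (allss (y :: p)) yp.
  move=> a b ayp byp /existsP[e' /andP[e'P1 e'ab]]; apply/existsP; exists e'.
  rewrite !inE e'P1 e'ab /= !andbT; apply: contraNneq syp => ee'; subst e'.
  move: e'ab esy; rewrite /joins => /orP[] /andP[/eqP-> /eqP->];
    by case/orP=> /andP[/eqP sa /eqP sb];
      first [by rewrite -sa | by rewrite -sb].
have vs : connect (edge_adj Q) v s.
  rewrite edge_adj_connectC; apply: edge_adjS con2; apply/subsetP => e' e'P2.
  rewrite !inE e'P2 orbT andbT; apply: contraTneq e'P2 => ->.
  by rewrite (disjointFr dis eP1).
have /connectP[q0 yq0] := connect_trans yv vs.
case/shortenP: yq0 => q yq uq _ sE.
have [c [c1 uc2 cQ cpath]] := walk_edges yq uq.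
have QP : Q \subset P1 :|: P2 by apply: subD1set.
have vy' : connect (edge_adj (P1 :|: P2)) v y.
  by rewrite edge_adj_connectC; apply: edge_adjS QP _ _ yv.
have vq x : x \in y :: q -> connect (edge_adj (P1 :|: P2)) v x.
  move=> xq; apply: connect_trans vy' _; apply: edge_adjS QP _ _ _.
  exact: path_connect yq _ xq.
exists ((s, e) :: c); split.
- apply/and4P; split=> //=.
  + by rewrite c1 sE -rcons_uniq -lastI.
  + rewrite uc2 andbT; apply/negP => /cQ[+ _ _].
    by rewrite !inE eqxx.
  + exact: cpath.
- move=> x; rewrite /= c1 inE => /predU1P[->|xq].
    by rewrite sE; apply: vq; apply: mem_last.
  by apply: vq; apply: mem_belast.
- move=> e'; rewrite /= inE => /predU1P[->|/cQ[e'Q e1 _]].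
    rewrite inE eP1 /=; case/orP: esy => /andP[/eqP-> _]; last exact: vy'.
    by rewrite sE; apply: vq; apply: mem_last.
  by rewrite (subsetP QP) //=; apply: vq.
- by rewrite /= inE eqxx.
Qed.

End Walks.

Lemma edge_connected_cut (G : graph) k (Y : {set vertex G}) x y :
  edge_connected G k -> x \in Y -> y \notin Y -> k <= #|cut setT Y|.
Proof.
move=> [_ conn] xY yY; rewrite leqNgt; apply/negP => /conn[_].
move=> /(_ x y); rewrite !inE => /(_ isT isT) con.
suff /closed_connect/(_ _ _ con) :
    closed (adjacent_in (delete_edges (cut setT Y))) (mem Y).
  by rewrite xY (negPf yY).
move=> a b /existsP[e /andP[]]; rewrite !inE /= negb_add => /eqP eY.
by case/orP=> /andP[/eqP <- /eqP <-].
Qed.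

(** The factor [2 * k] is the loss in [card_T_le], and the power bounds the size of a ball of radius
    [(2 * k).-1]. *)
Lemma d_ge k : 2 <= k -> 2 * k * (4 * k ^ 3) ^ (2 * k).-1 <= d k.
Proof.
move=> k2; rewrite /d.
have base : 4 * k ^ 3 <= (2 * k + 1) ^ 4.
  apply: (@leq_trans ((2 * k) ^ 4)); last by rewrite leq_exp2r //; lia.
  rewrite expnMn (expnS k 3) mulnA leq_mul2r; apply/orP; right.
  by rewrite -[2 ^ 4]/16; lia.
have pow : (4 * k ^ 3) ^ (2 * k).-1 <= (2 * k + 1) ^ (8 * k + 4).
  apply: (@leq_trans (((2 * k + 1) ^ 4) ^ (2 * k).-1)).
    by rewrite leq_exp2r //; lia.
  by rewrite -expnM leq_pexp2l //; lia.
have : 2 * k <= k ^ 2 * (k + 1) by rewrite -mulnn; nia.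
by move=> le; rewrite -(mulnA (_ ^ _)) [leqLHS]mulnC leq_mul.
Qed.

(* The sets [X] separate the branch vertices [r X] from [v]; since a cut of
   size [k] can carry only the [k] paths of its own branch vertex, the other
   paths never enter [X]. *)
Lemma exists_branch_system (G : graph) k n (v : vertex G) :
    2 <= k -> edge_connected G k -> 0 < n -> d k * n <= #|neighbors v| ->
  exists (E : {set edge G}) (I : {set {set vertex G}})
         (r : {set vertex G} -> vertex G),
    [/\ #|I| = n,
        {in I &, forall (X X' : {set vertex G}) x,
           x \in X -> x \in X' -> X = X'},
        {in I, forall X : {set vertex G},
           [/\ v \notin X, r X \in X & #|cut E X| <= k]} &
        forall Y : {set vertex G}, v \notin Y ->
          #|[set X in I | r X \in Y]| * k <= #|cut E Y|].
Proof.
move=> k2 conn n0 dn; set T := neighbors v in dn.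
have dk0 : 0 < d k.
  apply: leq_trans (d_ge k2).
  by rewrite !muln_gt0 expn_gt0 muln_gt0 expn_gt0; lia.
have /card_gt0P[t0 t0T] : 0 < #|T| by apply: leq_trans dn; rewrite muln_gt0 dk0.
have /fin_all_exists[spoke spokeP] t : exists e : edge G, t \in T -> joins e v t.
  have [|_] := boolP (t \in T).
    by rewrite inE => /andP[_ /existsP[e vt]]; exists e.
  by move: t0T; rewrite inE => /andP[_ /existsP[e _]]; exists e.
have vT : v \notin T by rewrite inE eqxx.
pose ok (E : {set edge G}) := (spoke @: T \subset E) &&
  [forall (Y : {set vertex G} | (v \notin Y) && (Y :&: T != set0)),
     k <= #|cut E Y|].
have ok0 : ok setT.
  rewrite /ok subsetT; apply/forall_inP => Y /andP[vY /set0Pn[t /setIP[tY _]]].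
  exact: edge_connected_cut conn tY vY.
have [E /minsetP[/andP[spE /forall_inP cutE] Emin] _] := minset_exists ok0.
have spokeE : {in T, forall t, spoke t \in E}.
  by move=> t tT; apply: (subsetP spE); apply: imset_f.
have cut_ge (Y : {set vertex G}) :
    v \notin Y -> Y :&: T != set0 -> k <= #|cut E Y|.
  by move=> vY YT; apply: cutE; rewrite vY.
have crit e : e \in E -> e \notin spoke @: T ->
    exists2 Y : {set vertex G}, tight k v T E Y & e \in cut E Y.
  (* By minimality, deleting [e] breaks the cut condition at some [Y]; hence [e] leaves [Y], and [Y]
     is tight in [E]. *)
  move=> eE nsp; have : ~~ ok (E :\ e).
    apply/negP => /Emin /(_ (subD1set _ _)) eqE.
    by move: eE; rewrite -eqE !inE eqxx.
  rewrite /ok subsetD1 spE nsp /= negb_forall => /existsP[Y].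
  rewrite negb_imply -ltnNge => /andP[/andP[vY YT] lt].
  have cE : cut (E :\ e) Y = cut E Y :\ e.
    by apply/setP => f; rewrite !inE -andbA.
  have := cardsD1 e (cut E Y); rewrite -cE => cD; have := cut_ge Y vY YT.
  case eY: (e \in cut E Y) cD => /= cD ge; last by clear -cD ge lt; lia.
  by exists Y => //; rewrite /tight vY YT cD; clear -lt; lia.
have [XX [triv tXX cover_XX]] := exists_tight_packing cut_ge crit.
have kk : 0 < k * k by rewrite muln_gt0; lia.
have [L [Lsmall Lfree]] := exists_edge_labels spokeP cover_XX kk.
have cT := card_T_le k2 vT spokeP spokeE cut_ge triv tXX cover_XX.
have [|I IXX [cI cutI]] := exists_spread_packing (n := n) k2 vT spokeP spokeE
  cut_ge triv tXX cover_XX Lsmall Lfree.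
  have h := leq_trans dn cT; have k0 : 0 < 2 * k by lia.
  rewrite -(leq_pmul2l k0); apply: leq_trans h; rewrite mulnCA mulnC.
  by rewrite leq_mul2r d_ge ?orbT.
exists E, I, (rep v T); split=> //.
  by move=> X X' IX IX' x; apply: (XX_inj triv); apply: (subsetP IXX).
move=> X /(subsetP IXX) XX_X; have [rX _] := repP tXX XX_X.
by have /and3P[vX _ cX] := tXX _ XX_X.
Qed.

(** A pair [(e, b)] is a half-edge of [e], so a loop has two half-edges at its vertex. *)
Definition foot (F : graph) (h : edge F * bool) : vertex F :=
  if h.2 then end1 h.1 else end2 h.1.

(** The degree of a vertex counts its half-edges, which are numbered below [k] by their positions in
    an enumeration. *)
Lemma exists_slots (F : graph) k : max_degree F <= k ->
  exists slot : edge F * bool -> 'I_k,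
    forall h h', foot h = foot h' -> slot h = slot h' -> h = h'.
Proof.
move=> degF; pose H (u : vertex F) := [set h | foot h == u].
have cH u : #|H u| <= k.
  apply: leq_trans degF; apply: leq_trans (leq_bigmax u); rewrite /degree.
  rewrite -sum1_card (eq_bigl (fun h => foot h == u)); last first.
    by move=> h; rewrite inE.
  rewrite big_mkcond /=.
  rewrite -(pair_bigA _ (fun e b => if foot (e, b) == u then 1 else 0)).
  by apply: leq_sum => e _; rewrite /= big_bool /foot /=; do 2 case: eqP.
have lt h : index h (enum (H (foot h))) < k.
  by apply: leq_trans (cH (foot h)); rewrite cardE index_mem mem_enum inE.
exists (fun h => Ordinal (lt h)) => /= h h' hh' /(congr1 val) /=.
rewrite -hh' => eq_index.
by apply: (index_inj h _ _ eq_index); rewrite mem_enum inE ?hh'.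
Qed.

Theorem corollary3 (k : nat) (F G : graph)
  (k_ge3 : 3 <= k)
  (F_deg : max_degree F <= k)
  (G_conn : edge_connected G k)
  (G_vertex : exists v : vertex G, d k * #|vertex F| <= #|neighbors v|) :
  appears_as_strong_immersion F G.
Proof.
have k0 : 0 < k by lia.
have [v dn] := G_vertex.
have [slot slot_inj] := exists_slots F_deg.
(* The branch system is available only for a positive number of branch vertices; if [F] has no
   vertices, it has no edges either. *)
have [F0|Fn] := posnP #|vertex F|.
  have no (u : vertex F) : False by have := fintype0 u F0.
  exists (@Immersion F G (fun u => False_rect _ (no u))
    (fun e => False_rect _ (no (end1 e))) (fun u => False_ind _ (no u))
    (fun e => False_ind _ (no (end1 e))) (fun e => False_ind _ (no (end1 e)))
    (fun e => False_ind _ (no (end1 e))) (fun e => False_ind _ (no (end1 e)))).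
  by move=> e; case: (no (end1 e)).
have [E [I [r [cI disjI sepI cutI]]]] :=
  exists_branch_system (ltnW k_ge3) G_conn Fn dn.
pose X u := enum_val (cast_ord (esym cI) (enum_rank u)).
have IX u : X u \in I by apply: enum_valP.
have X_inj : injective X.
  by move=> u w /enum_val_inj /cast_ord_inj /enum_rank_inj.
pose theta u := r (X u).
have thetaX u : theta u \in X u by have [] := sepI _ (IX u).
have vX u : v \notin X u by have [] := sepI _ (IX u).
have theta_inj : injective theta.
  move=> u w eq_uw; apply: X_inj.
  apply: (disjI _ _ (IX u) (IX w) (theta u)) => //.
  by rewrite eq_uw.
pose src (p : vertex F * 'I_k) := theta p.1.
have [|P [PE Pdisj Pcon]] := @disjoint_paths_to G E v _ src.
  move=> Y vY; apply: leq_trans (cutI Y vY).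
  have -> : src @^-1: Y = setX [set u | theta u \in Y] setT.
    by apply/setP => -[u a]; rewrite !inE andbT.
  rewrite cardsX cardsT card_ord leq_mul2r; apply/orP; right.
  rewrite -(card_imset _ X_inj); apply: subset_leq_card.
  by apply/subsetP => Z /imsetP[u]; rewrite !inE => uY ->; rewrite IX.
(* Each of the [k] disjoint paths from [theta u] crosses the cut of [X u], which has at most [k]
   edges. They use it up, so a path from another branch vertex has no edge there. *)
have avoid u w b : w != u -> [disjoint P (w, b) & cut E (X u)].
  move=> wu.
  have /fin_all_exists[g gP] a : exists e, e \in P (u, a) :&: cut E (X u).
    have [e ec] := connect_cross (Pcon (u, a)) (thetaX u) (vX u).
    exists e; move: ec; rewrite !inE => /andP[eP ->].
    by rewrite eP (subsetP (PE _) _ eP).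
  have g_inj : injective g.
    move=> a a' eq_g; apply/eqP; apply: contraT => ne.
    have /Pdisj dis : (u, a) != (u, a') by rewrite xpair_eqE eqxx.
    have /setIP[ga _] := gP a; have /setIP[ga' _] := gP a'.
    by have := disjointFr dis ga; rewrite eq_g ga'.
  have /eqP gcut : [set g a | a in 'I_k] == cut E (X u).
    rewrite eqEcard card_imset // card_ord; have [_ _ ->] := sepI _ (IX u).
    by rewrite andbT; apply/subsetP => e /imsetP[a _ ->]; have /setIP[] := gP a.
  rewrite -setI_eq0; apply/eqP/setP => e; rewrite [RHS]inE; apply/negP.
  rewrite -gcut => /setIP[eP /imsetP[a _ ea]].
  have /Pdisj dis : (w, b) != (u, a) by rewrite xpair_eqE (negPf wu).
  have /setIP[] := gP a; rewrite -ea => eP' _.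
  by have := disjointFr dis eP; rewrite eP'.
(* The slot selects one of the [k] paths at the foot of [h], so distinct half-edges receive disjoint
   paths. *)
pose strand h := P (foot h, slot h).
have strand_disj h h' : h != h' -> [disjoint strand h & strand h'].
  move=> ne; apply: Pdisj; apply: contra ne; rewrite xpair_eqE.
  by case/andP=> /eqP fh /eqP sh; apply/eqP; apply: slot_inj.
have strand_con h : connect (edge_adj (strand h)) (theta (foot h)) v.
  exact: Pcon (foot h, slot h).
pose Q e := strand (e, true) :|: strand (e, false).
have Q_ind e u : incident e u ->
    exists b, foot (e, b) = u /\ strand (e, b) \subset Q e.
  case/orP=> /eqP <-; [exists true | exists false]; split=> //.
    exact: subsetUl.
  exact: subsetUr.
have Q_disj e f : e != f -> [disjoint edges (component (Q e) v)
                                    & edges (component (Q f) v)].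
  move=> ne; apply: disjointWl (_ : [disjoint Q e & _]).
    by apply/subsetP => x; rewrite inE => /andP[].
  apply: disjointWr (_ : [disjoint _ & Q f]).
    by apply/subsetP => x; rewrite inE => /andP[].
  by rewrite -setI_eq0 /Q setIUl !setIUr !setU_eq0 !setI_eq0 !strand_disj //
    xpair_eqE (negPf ne).
have Q_inc e u : incident e u -> theta u \in verts (component (Q e) v).
  case/Q_ind=> b [<- sub]; rewrite inE edge_adj_connectC.
  exact: edge_adjS sub _ _ (strand_con _).
have Q_loop e u : incident e u -> is_loop e ->
    contains_cycle_through (component (Q e) v) (theta u).
  move=> inc /eqP loop; have eu : end1 e = u.
    by case/orP: inc => /eqP //; rewrite loop.
  apply: cycle_of_two_paths.
  - by apply: contraNneq (vX u) => <-.
  - by apply: strand_disj; rewrite xpair_eqE andbF.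
  - by rewrite -eu; apply: (strand_con (e, true)).
  - by rewrite -eu loop; apply: (strand_con (e, false)).
exists (@Immersion F G theta (fun e => component (Q e) v) theta_inj
  (fun e => component_connected (Q e) v) Q_disj Q_inc Q_loop).
move=> e u /=; rewrite negb_or => /andP[u1 u2]; rewrite inE; apply/negP.
(* If the image of [e] contained [theta u], a strand of [e] would have an edge in the cut of [X u],
   although neither foot of [e] is [u]. *)
rewrite edge_adj_connectC => /connect_cross /(_ (thetaX u) (vX u))[f].
rewrite inE => /andP[fQ fX].
have QE : Q e \subset E by rewrite subUset !PE.
have fcut : f \in cut E (X u) by rewrite inE (subsetP QE).
case/setUP: fQ => fP.
  by have := disjointFr (avoid u _ _ u1) fP; rewrite fcut.
by have := disjointFr (avoid u _ _ u2) fP; rewrite fcut.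
Qed.
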